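(* Let $\alpha\in(0,1)$ and let $\omega=(\omega_0,\omega_1,\dots)$ be the coefficients of the $\mathcal L1$ scheme: $$\omega_0=\frac1{\Gamma(2-\alpha)},\qquad \omega_j=\frac{1}{\Gamma(2-\alpha)}\left((j+1)^{1-\alpha}-2j^{1-\alpha}+(j-1)^{1-\alpha}\right),\quad j\ge1 .$$ Then the convolution inverse $a=\omega^{(-1)}$ is a completely monotone sequence. Hence the $\mathcal L1$ scheme is $\mathcal{CM}$-preserving.
   Context: A real sequence $v=(v_0,v_1,\dots)$ is completely monotone if $((I-E)^jv)_k\ge 0$ for all $j,k\ge 0$, where $(Ev)_k=v_{k+1}$. Convolution of sequences: $(u*v)_n=\sum_{j=0}^n u_jv_{n-j}$, with identity $\delta_d=(1,0,0,\dots)$; $\omega^{(-1)}$ is the sequence with $\omega*\omega^{(-1)}=\delta_d$. For $\alpha\in(0,1)$ and step size $h>0$, a sequence $\omega$ defines the scheme $h^{-\alpha}\sum_{j=0}^n\omega_j(u_{n-j}-u_0)=f(t_n,u_n)$, $n\ge1$, $t_n=nh$, for the Caputo fractional ODE $\mathcal D_c^\alpha u=f(t,u)$, $u(0)=u_0$. With $a=\omega^{(-1)}$ and $F_a(z)=\sum_{n\ge0}a_nz^n$, the scheme is consistent if $h^\alpha F_a(e^{-h})=1+o(1)$ as $h\to0^+$. A scheme is $\mathcal{CM}$-preserving if it is consistent and $a=\omega^{(-1)}$ is a completely monotone sequence. *)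

(* Defs.v *)
From HB Require Import structures.
From mathcomp Require Import all_boot all_order all_algebra.
From mathcomp Require Import all_classical all_reals all_analysis.
Set Implicit Arguments.
Unset Strict Implicit.
Unset Printing Implicit Defensive.
Import Order.TTheory GRing.Theory Num.Theory.
Import numFieldNormedType.Exports.
Local Open Scope classical_set_scope.
Local Open Scope ring_scope.

Section Definitions.
Variable R : realType.
Implicit Types (u v w a : nat -> R) (alpha x z h : R).

Definition Gamma x : R :=
  \int[lebesgue_measure]_(t in `]0, +oo[) (t `^ (x - 1) * expR (- t)).

Definition seq_shift v : nat -> R := fun k => v k.+1.

Definition completely_monotone v : Prop :=
  forall j k : nat, 0 <= iter j (fun w => w \- seq_shift w) v k.

Definition convolution u v : nat -> R :=
  fun n => \sum_(j < n.+1) u j * v (n - j)%N.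

Definition delta_d : nat -> R := fun n => (n == 0%N)%:R.

(* Meaningful when [u 0 != 0], see [conv_invP] and [conv_inv_uniq];
   the zero sequence when no inverse exists. *)
Definition conv_inv u : nat -> R :=
  xget (fun=> 0) [set a | convolution u a = delta_d].

Definition gen_fun a z : R := limn (pseries a z).

(* A scheme is identified with its order [alpha] and its coefficients [w].
   As [limn] is total, the convergence of the power series at [expR (- h)],
   implicit in writing its sum, is made explicit. *)
Definition consistent alpha w : Prop :=
  (\forall h \near 0^'+, cvgn (pseries (conv_inv w) (expR (- h)))) /\
  h `^ alpha * gen_fun (conv_inv w) (expR (- h)) @[h --> 0^'+] --> (1 : R).

Definition CM_preserving alpha w : Prop :=
  consistent alpha w /\ completely_monotone (conv_inv w).

(* For [j = 1] the last power is [0 `^ (1 - alpha)], which is [0] when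
   [alpha != 1]. *)
Definition L1_coef alpha : nat -> R := fun j =>
  if j == 0%N then (Gamma (2 - alpha))^-1
  else (Gamma (2 - alpha))^-1 *
    (j.+1%:R `^ (1 - alpha) - 2 * j%:R `^ (1 - alpha)
     + j.-1%:R `^ (1 - alpha)).

Lemma conv_inv_uniq u a b : convolution u a = delta_d ->
  convolution u b = delta_d -> a = b.
Proof.
move=> ua ub.
have u0 : u 0%N != 0.
  apply/eqP => u0; have := congr1 (fun v => v 0%N) ua.
  rewrite /convolution /delta_d big_ord1 u0 mul0r eqxx => /esym/eqP.
  by rewrite oner_eq0.
apply/funext; elim/ltn_ind => n IHn.
have := congr1 (fun v => v n) (etrans ua (esym ub)).
rewrite /convolution !big_ord_recl /= subn0.
rewrite [X in _ + X = _](eq_bigr (fun i : 'I_n => u i.+1 * b (n - i.+1)%N)).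
  by move/addIr/(mulfI u0).
by move=> i _; rewrite /bump /= add1n IHn// ltn_subrL (leq_ltn_trans _ (ltn_ord i)).
Qed.

Lemma conv_invP u : u 0%N != 0 -> convolution u (conv_inv u) = delta_d.
Proof.
move=> u0.
suff [a ua] : exists a, convolution u a = delta_d by apply: (xgetPex (fun=> 0) (P := [set a | convolution u a = delta_d])); exists a.
pose next (s : seq R) := rcons s ((u 0%N)^-1 *
  (delta_d (size s) - \sum_(i < size s) u i.+1 * s`_(size s - i.+1))).
pose S n := iter n next [::].
have sS n : size (S n) = n by elim: n => //= n IH; rewrite /next size_rcons IH.
have nS k n : (k < n)%N -> (S n)`_k = (S k.+1)`_k.
  elim: n => // n IH; rewrite ltnS leq_eqVlt => /orP[/eqP->//|kn].
  by rewrite [S n.+1]/= /next nth_rcons sS kn IH.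
exists (fun n => (S n.+1)`_n); apply/funext => n.
rewrite /convolution big_ord_recl /= subn0.
rewrite {1}/next nth_rcons -/(S n) sS ltnn eqxx mulVKf//.
rewrite [X in _ + X](eq_bigr (fun i : 'I_n => u i.+1 * (S n)`_(n - i.+1))) ?subrK//.
move=> i _; rewrite /bump /= add1n -[next (S _)]/(S (n - i.+1).+1) -(nS _ n)//.
by rewrite ltn_subrL (leq_ltn_trans _ (ltn_ord i)).
Qed.

End Definitions.

(* Main.v *)
Require Import Defs.
From HB Require Import structures.
From mathcomp Require Import all_boot all_order all_algebra.
From mathcomp Require Import all_classical all_reals all_analysis.
From mathcomp Require Import measurable_realfun.
From mathcomp Require Import ring lra zify.

(** Put [r = 1 - alpha], [G = Gamma (2 - alpha)] and
    [b_n = ((n + 1)^r - n^r) / G]. The weights of the scheme are the differences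
    [b_n - b_(n-1)], so with generating functions [F_w(z) = (1 - z) F_b(z)] and the
    inverse sequence satisfies [F_a(z) = 1 / ((1 - z) F_b(z))]. The sequence [b] is
    completely monotone because [x^r] is a Bernstein function: its successive
    differences have alternating signs by the mean value theorem
    ([powR_increments_CM]).

    The main point is that [1 / ((1 - z) F_b(z))] has completely monotone
    coefficients as soon as [b] is completely monotone
    ([completely_monotone_inverse]). In complex analysis this would follow from the
    theory of Pick functions; the proof below is algebraic. Let [L_v] be the linear
    functional on polynomials that sends [x^n] to [v_n]. Complete monotonicity of
    [v] says that [L_v] is nonnegative on the products [x^k (1 - x)^j]; conversely,
    for a completely monotone [v], Bernstein approximation shows that [L_v] is
    nonnegative on every polynomial that is nonnegative on [[0, 1]]
    ([moment_ge0]). Since [x^k (1 - x)^j] is a square multiplied by [1], [x],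
    [1 - x] or [x (1 - x)], complete monotonicity amounts to the positivity of four
    Hankel forms. Now the Hankel matrices of a power series and of its inverse are
    congruent up to sign through a triangular Toeplitz matrix, because
    [(1/U(x) - 1/U(y)) / (x - y) = - (U(x) - U(y)) / (U(x) U(y) (x - y))]
    ([moment_XM_poly_part], [moment_poly_partXM]). This transports the positivity of
    the four forms from [b] to [a].

    For consistency, summation by parts writes [h^r G F_b(e^(-h))] as a Riemann
    sum with mesh [h] of the integral of [t^r e^(-t)], which defines [G]; the sum
    lies between [G] and [G + h^r] ([gen_fun_increments_bounds]). Then
    [h^alpha F_a(e^(-h))] lies between [G / (G + h^r)] and [e^h]
    ([L1_consistency_bounds]), and both bounds tend to [1]. *)

Set Implicit Arguments.
Unset Strict Implicit.
Unset Printing Implicit Defensive.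
Import Order.TTheory GRing.Theory Num.Theory.
Import numFieldNormedType.Exports.
Local Open Scope classical_set_scope.
Local Open Scope ring_scope.

(** * Moment functionals and Hankel forms of inverse power series *)

Section LinearExtension.
Variables (R : realType) (V : lmodType R).
Implicit Types (f g : nat -> V) (p q : {poly R}).

(** Linear functionals and linear operators on polynomials are both given by
    their values on the monomials; [lin_ext] treats the two cases at once. *)
Definition lin_ext f p : V := \sum_(i < size p) p`_i *: f i.

Lemma lin_extE f p n : (size p <= n)%N ->
  lin_ext f p = \sum_(i < n) p`_i *: f i.
Proof.
move=> pn; rewrite /lin_ext (big_ord_widen n (fun i => p`_i *: f i) pn).
rewrite big_mkcond; apply: eq_bigr => i _; case: ltnP => // pi.
by rewrite nth_default ?scale0r.
Qed.

Lemma lin_ext_is_linear f : linear (lin_ext f).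
Proof.
move=> c p q; set n := maxn (size p) (size q).
have pn : (size p <= n)%N by rewrite leq_maxl.
have qn : (size q <= n)%N by rewrite leq_maxr.
have pqn : (size (c *: p + q)%R <= n)%N.
  rewrite (leq_trans (size_polyD _ _))// geq_max qn andbT.
  by rewrite (leq_trans (size_scale_leq _ _)).
rewrite !(lin_extE _ pn, lin_extE _ qn, lin_extE _ pqn) scaler_sumr -big_split /=.
by apply: eq_bigr => i _; rewrite coefD coefZ scalerDl scalerA.
Qed.

HB.instance Definition _ f := GRing.isLinear.Build R {poly R} V _ (lin_ext f)
  (lin_ext_is_linear f).

Lemma lin_extXM f p : lin_ext f ('X * p) = lin_ext (fun i => f i.+1) p.
Proof.
have pn : (size ('X * p)%R <= (size p).+1)%N.
  by rewrite (leq_trans (size_polyMleq _ _))// size_polyX.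
rewrite (lin_extE _ pn) big_ord_recl coefXM eqxx scale0r add0r.
by apply: eq_bigr => i _; rewrite coefXM.
Qed.

Lemma lin_ext1 f : lin_ext f 1 = f 0%N.
Proof. by rewrite /lin_ext size_poly1 big_ord1 coef1 scale1r. Qed.

End LinearExtension.

Arguments lin_ext {R V}.

Lemma lin_ext_comp (R : realType) (V W : lmodType R)
    (h : {linear V -> W}) (f : nat -> V) (p : {poly R}) :
  h (lin_ext f p) = lin_ext (fun i => h (f i)) p.
Proof. by rewrite linear_sum; apply: eq_bigr => i _; rewrite linearZ. Qed.

(** If [v] were the moment sequence of a measure, this would be the integral
    of [p] against it. *)
Definition moment (R : realType) (v : nat -> R) : {poly R} -> R^o :=
  lin_ext (v : nat -> R^o).
HB.instance Definition _ (R : realType) (v : nat -> R) :=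
  GRing.Linear.on (moment v).

(** The polynomial part of [p(x) V(1/x)], where [V] is the generating function
    of [v]; as a matrix, the transpose of the Toeplitz matrix of [v]. *)
Definition poly_part (R : realType) (v : nat -> R) : {poly R} -> {poly R} :=
  lin_ext (fun i => \poly_(j < i.+1) v (i - j)%N).
HB.instance Definition _ (R : realType) (v : nat -> R) :=
  GRing.Linear.on (poly_part v).

Section PolynomialPart.
Variable R : realType.
Implicit Types (u v w : nat -> R) (p q : {poly R}) (c : R).

Lemma momentE v p : moment v p = \sum_(i < size p) p`_i * v i.
Proof. by []. Qed.

Lemma moment_delta p : moment (@delta_d R) p = p`_0.
Proof.
rewrite /moment (lin_extE _ (leqnSn _)) big_ord_recl /= big1 ?addr0.
  by rewrite /delta_d /= [_ *: _]mulr1.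
by move=> i _; rewrite /delta_d /= scaler0.
Qed.

Lemma momentC v c : moment v c%:P = c * v 0%N.
Proof. by rewrite -[c%:P]mulr1 mul_polyC linearZ /= /moment lin_ext1. Qed.

Lemma moment_shift v p : moment (seq_shift v) p = moment v ('X * p).
Proof. by rewrite /moment lin_extXM. Qed.

Lemma moment_sub u v p : moment (u \- v) p = moment u p - moment v p.
Proof.
rewrite !momentE -sumrB; apply: eq_bigr => i _.
by rewrite -mulrBr.
Qed.

Lemma moment_diff v p :
  moment (v \- seq_shift v) p = moment v ((1 - 'X) * p).
Proof. by rewrite moment_sub moment_shift -linearB /= mulrBl mul1r. Qed.

(** Complete monotonicity is positivity of the moment functional on the products
    [x^k (1 - x)^j]: the shift [E] of sequences is multiplication by [x] on
    the side of polynomials. *)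
Lemma iter_diff_moment v j k :
  iter j (fun w => w \- seq_shift w) v k = moment v ('X^k * (1 - 'X) ^+ j).
Proof.
elim: j v k => [|j IH] v k.
  rewrite mulr1; elim: k v => [|k IH] v; first by rewrite /moment lin_ext1.
  by rewrite exprS -moment_shift -IH.
by rewrite iterSr IH moment_diff exprS mulrCA.
Qed.

Lemma poly_part1 v : poly_part v 1 = (v 0%N)%:P.
Proof.
rewrite /poly_part lin_ext1; apply/polyP => i.
by rewrite coef_poly coefC ltnS leqn0; case: eqP => // ->.
Qed.

(** The coefficients of [x p(x) V(1/x)] are those of [p(x) V(1/x)] moved up by
    one place, except for the constant one, which crosses from negative powers. *)
Lemma poly_partXM v p : poly_part v ('X * p) = 'X * poly_part v p + (moment v ('X * p))%:P.
Proof.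
rewrite /poly_part /moment !lin_extXM -alg_polyC scaler_suml mulr_sumr -big_split /=.
apply: eq_bigr => i _; rewrite -scalerAr -scalerA -scalerDr; congr (_ *: _).
rewrite alg_polyC; apply/polyP => -[|j]; rewrite !(coefD, coef_poly, coefXM, coefC) /=.
  by rewrite add0r.
by rewrite addr0 subSS.
Qed.

Lemma moment_poly_part u v p : moment u (poly_part v p) = moment (convolution u v) p.
Proof.
rewrite /poly_part lin_ext_comp; apply: eq_bigr => i _; congr (_ *: _).
have sz := size_poly i.+1 (fun j => v (i - j)%N).
rewrite [LHS](@lin_extE R R^o u _ i.+1 sz); apply: eq_bigr => j _.
by rewrite coef_poly ltn_ord [LHS]mulrC.
Qed.

Lemma poly_XM_ind (P : {poly R} -> Prop) : P 0 ->
  (forall p c, P p -> P (c%:P + 'X * p)) -> forall p, P p.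
Proof.
by move=> P0 PX; elim/poly_ind => // p c /(PX _ c); rewrite addrC [p * _]mulrC.
Qed.

Lemma poly_partC v c : poly_part v c%:P = (c * v 0%N)%:P.
Proof. by rewrite -[c%:P]mulr1 mul_polyC linearZ /= poly_part1 -mul_polyC polyCM. Qed.

Lemma poly_part_comp u v p : poly_part u (poly_part v p) = poly_part (convolution u v) p.
Proof.
elim/poly_XM_ind: p => [|p c IH]; first by rewrite !linear0.
rewrite !linearD /= !poly_partC; congr (_ + _).
  by rewrite /convolution big_ord1 subnn; congr (_%:P); ring.
rewrite !poly_partXM linearD /= poly_partC poly_partXM IH -addrA -polyCD; congr (_ + _%:P).
by rewrite -moment_poly_part poly_partXM linearD /= momentC.
Qed.

Lemma poly_part_delta p : poly_part (@delta_d R) p = p.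
Proof.
elim/poly_XM_ind: p => [|p c IH]; first by rewrite !linear0.
by rewrite linearD /= poly_partC poly_partXM IH moment_delta coefXM addr0
  [delta_d R 0]/= mulr1.
Qed.

(** The Hankel matrix [(v_(i+j+1))] has generating function
    [(V(x) - V(y)) / (x - y)]. When [V = 1 / U] this equals
    [- V(x) V(y) (U(x) - U(y)) / (x - y)], so the Hankel matrices of two inverse
    sequences are opposite up to a triangular congruence. The lemma is this
    congruence written as an identity of bilinear forms; induction on [p]
    transfers one factor [x] from [p] to [q]. *)
Lemma moment_XM_poly_part u v p q : convolution v u = @delta_d R ->
  moment v ('X * poly_part u p * poly_part u q) = - moment u ('X * p * q).
Proof.
move=> vu.
have v0 : v 0%N * u 0%N = 1.
  by have := congr1 (fun w => w 0%N) vu; rewrite /convolution big_ord1 subnn.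
have mX r : moment v ('X * poly_part u r) = - (v 0%N) * moment u ('X * r).
  have := moment_poly_part v u ('X * r); rewrite vu moment_delta coefXM eqxx.
  by rewrite poly_partXM linearD /= momentC => /eqP; rewrite addr_eq0 => /eqP->; ring.
elim/poly_XM_ind: p q => [|p c IH] q.
  by rewrite linear0 !(mulr0, mul0r) !linear0.
rewrite linearD /= poly_partC poly_partXM.
set l := moment u ('X * p).
transitivity (c * u 0%N * moment v ('X * poly_part u q)
   + moment v ('X * poly_part u p * ('X * poly_part u q))
   + l * moment v ('X * poly_part u q)).
  rewrite -!linearZ -!linearD /=; congr (moment v _).
  by rewrite -!mul_polyC; ring.
have -> : 'X * poly_part u q = poly_part u ('X * q) - (moment u ('X * q))%:P.
  by rewrite poly_partXM addrK.
rewrite mulrBr !linearB /= IH [_ * _%:P]mulrC mul_polyC linearZ /= mX momentC.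
have -> : moment v (poly_part u ('X * q)) = 0.
  by rewrite moment_poly_part vu moment_delta coefXM.
have -> : moment u ('X * (c%:P + 'X * p) * q) =
   c * moment u ('X * q) + moment u ('X * p * ('X * q)).
  by rewrite -!linearZ -!linearD /=; congr (moment u _); rewrite -!mul_polyC; ring.
rewrite -/l.
move: (moment u ('X * p * ('X * q))) (moment u ('X * q)) l v0 => x y z v0.
suff: c * u 0%N * (0 - y * v 0%N) + (- x - y * (- v 0%N * z : R)) +
  (z : R) * (0 - y * v 0%N) = - (c * y + x) by [].
have -> : c * u 0%N * (0 - y * v 0%N) = - c * y * (v 0%N * u 0%N) by ring.
by rewrite v0; ring.
Qed.

(** The same congruence for the Hankel matrices without shift: the first row and
    column of that of [u] have to be left out, whence the factors ['X]. *)
Lemma moment_poly_partXM u v p q : convolution v u = @delta_d R ->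
  moment v (poly_part u ('X * p) * poly_part u ('X * q)) = - moment u ('X * p * ('X * q)).
Proof.
move=> vu; rewrite [poly_part u ('X * q)]poly_partXM mulrDr linearD /=.
rewrite mulrCA mulrA (moment_XM_poly_part _ _ vu) [_ * _%:P]mulrC mul_polyC linearZ /=.
rewrite moment_poly_part vu moment_delta coefXM eqxx scaler0 addr0.
by congr (- moment u _); ring.
Qed.

End PolynomialPart.

(** * Positivity of the moments of a completely monotone sequence *)

Section Hausdorff.
Variable R : realType.
Implicit Types (v : nat -> R) (p q : {poly R}) (m n k : nat).

(** The value of the moment functional of [v] on the Bernstein polynomial of
    index [k] and degree [n]. *)
Definition bernstein_weight v n k : R :=
  'C(n, k)%:R * iter (n - k) (fun w => w \- seq_shift w) v k.

Lemma bernstein_weight_ge0 v n k : completely_monotone v ->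
  0 <= bernstein_weight v n k.
Proof. by move=> vcm; rewrite mulr_ge0// vcm. Qed.

(** The Bernstein expansion of [x^m (x + (1 - x))^(n - m)], with the coefficient
    ['C(n - m, k - m)] rewritten as ['C(n, k)] times a ratio of falling
    factorials. *)
Lemma moment_Xn_bernstein v n m : (m <= n)%N ->
  v m = \sum_(k < n.+1) (k ^_ m)%:R / (n ^_ m)%:R * bernstein_weight v n k.
Proof.
move=> mn.
have nm0 : (n ^_ m)%:R != 0 :> R by rewrite pnatr_eq0 -lt0n ffact_gt0.
have -> : v m = moment v ('X^m * (('X + (1 - 'X)) ^+ (n - m))).
  by rewrite addrC subrK expr1n; have := iter_diff_moment v 0 m.
rewrite addrC exprDn mulr_sumr linear_sum /=.
rewrite -(big_mkord xpredT (fun k => (k ^_ m)%:R / (n ^_ m)%:R * bernstein_weight v n k)).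
rewrite [RHS](big_cat_nat (n := m)) ?leqW//=.
rewrite [X in _ = X + _]big_nat_cond [X in _ = X + _]big1 ?add0r; last first.
  by move=> k /andP[/andP[_ km] _]; rewrite ffact_small// mul0r mul0r.
rewrite -[X in \sum_(X <= _ < _) _]add0n big_addn subSn// big_mkord.
apply: eq_bigr => k _.
rewrite /bernstein_weight iter_diff_moment.
have kn : (k + m <= n)%N by have := ltn_ord k; rewrite ltnS leq_subRL// addnC.
have -> : (n - (k + m) = n - m - k)%N by rewrite addnC subnDA.
rewrite mulrnAr linearMn /= -[LHS]mulr_natl [in RHS]mulrA; congr (_ * _); last first.
  by congr (moment v _); rewrite mulrCA -exprD mulrC addnC.
  apply: (mulfI nm0); rewrite mulrA [_ / _]mulrC mulrA mulfV// mul1r.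
  rewrite -!natrM; congr (_%:R).
  rewrite addnC in kn *.
  have kmn : (k <= n - m)%N by rewrite leq_subRL.
  have := bin_fact kn; have := bin_fact kmn; have := ffact_fact mn.
  have := ffact_fact (leq_addr k m); rewrite addKn subnDA => E1 E2 E3 E4.
  have f0 : (0 < k`! * (n - m - k)`!)%N by rewrite muln_gt0 !fact_gt0.
  by apply/eqP; rewrite -(eqn_pmul2r f0); apply/eqP; nia.
Qed.

Lemma bernstein_weight_sum v n : \sum_(k < n.+1) bernstein_weight v n k = v 0%N.
Proof.
rewrite (moment_Xn_bernstein v (leq0n n)); apply: eq_bigr => k _.
by rewrite !ffactn0 divr1 mul1r.
Qed.

(** The bound is uniform in [k], which makes the moments of the discrete measure
    of masses [bernstein_weight v n k] at [k / n] converge to those of [v]. *)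
Lemma ffact_ratio_approx m n k : (m < n)%N -> (k <= n)%N ->
  `|(k ^_ m)%:R / (n ^_ m)%:R - (k%:R / n%:R) ^+ m| <= m%:R ^+ 2 / (n - m)%:R :> R.
Proof.
elim: m => [|m IH] mn kn.
  by rewrite !ffactn0 expr0 divr1 subrr normr0 divr_ge0// exprn_ge0.
have m1n : (m < n)%N by rewrite ltnW.
have n0 : (0 : R) < n%:R by rewrite ltr0n (leq_trans _ mn).
have x01 : 0 <= (k%:R / n%:R : R) <= 1.
  by apply/andP; split; [exact: divr_ge0|rewrite ler_pdivrMr// mul1r ler_nat].
set x := k%:R / n%:R in x01 *.
set r := (k ^_ m)%:R / (n ^_ m)%:R : R.
have nm0 : (0 : R) < (n ^_ m)%:R by rewrite ltr0n ffact_gt0 ltnW.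
have nm1 : (0 : R) < (n - m)%:R by rewrite ltr0n subn_gt0.
have nm2 : (0 : R) < (n - m.+1)%:R by rewrite ltr0n subn_gt0.
have r01 : 0 <= r <= 1.
  apply/andP; split; [exact: divr_ge0|rewrite ler_pdivrMr// mul1r ler_nat].
  elim: m {IH mn m1n r nm0 nm1 nm2} => // m IH; rewrite !ffactnSr leq_mul//.
  exact: leq_sub2r.
have -> : (k ^_ m.+1)%:R / (n ^_ m.+1)%:R = r * ((k - m)%:R / (n - m)%:R).
  by rewrite !ffactnSr !natrM invfM mulrACA.
set y := (k - m)%:R / (n - m)%:R.
have ryx : `|r * (y - x)| <= m%:R / (n - m)%:R.
  have [km|mk] := ltnP k m; first by rewrite /r ffact_small// !mul0r normr0 divr_ge0.
  rewrite normrM (ger0_norm (proj1 (andP r01))).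
  apply: (@le_trans _ _ `|y - x|).
    by rewrite ler_piMl// (proj2 (andP r01)).
  have -> : y - x = - (m%:R / (n - m)%:R * ((n - k)%:R / n%:R)).
    have nm' : (n%:R - m%:R : R) != 0 by rewrite -natrB ?gt_eqF// ltnW.
    by rewrite /y /x !natrB ?(ltnW m1n)//; field; rewrite nm' gt_eqF.
  rewrite normrN ger0_norm ?mulr_ge0 ?invr_ge0//.
  rewrite ler_piMr ?divr_ge0// ler_pdivrMr// mul1r ler_nat leq_subr//.
have -> : r * y - x ^+ m.+1 = (r - x ^+ m) * x + r * (y - x) by rewrite exprSr; ring.
apply: (le_trans (ler_normD _ _)).
apply: (@le_trans _ _ (m%:R ^+ 2 / (n - m)%:R + m%:R / (n - m)%:R)).
  apply: lerD => //; rewrite normrM (ger0_norm (proj1 (andP x01))).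
  by apply: (le_trans _ (IH m1n kn)); rewrite ler_piMr// (proj2 (andP x01)).
rewrite -mulrDl ler_pM ?addr_ge0 ?exprn_ge0 ?invr_ge0//.
  by rewrite -natr1; have : (0 : R) <= m%:R by []; nra.
by rewrite lef_pV2 ?posrE// ler_nat leq_sub2l.
Qed.

(** Hausdorff's theorem in weak form. The Bernstein sum of [p] is a nonnegative
    combination of nonnegative weights, and it differs from the moment of [p]
    by [O(1 / n)]. *)
Lemma moment_ge0 v p : completely_monotone v ->
  (forall x : R, 0 <= x <= 1 -> 0 <= p.[x]) -> 0 <= moment v p.
Proof.
move=> vcm p0; set d := size p.
(* A bound for the error on [x^i], with [i < d], is [d^2 v_0 / (n - d)]. *)
pose K := \sum_(i < d) `|p`_i| * d%:R ^+ 2 * v 0%N.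
have v00 : 0 <= v 0%N := vcm 0%N 0%N.
have K0 : 0 <= K by apply: sumr_ge0 => i _; rewrite !mulr_ge0// exprn_ge0.
have bound n : (d < n)%N -> - (K / (n - d)%:R) <= moment v p.
  move=> dn.
  have nd0 : (0 : R) < (n - d)%:R by rewrite ltr0n subn_gt0.
  pose B := \sum_(k < n.+1) p.[k%:R / n%:R] * bernstein_weight v n k.
  have B0 : 0 <= B.
    apply: sumr_ge0 => k _; rewrite mulr_ge0 ?bernstein_weight_ge0// p0//.
    have n0 : (0 : R) < n%:R by rewrite ltr0n (leq_trans _ dn).
    apply/andP; split; first exact: divr_ge0.
    by rewrite ler_pdivrMr// mul1r ler_nat -ltnS.
  have E : moment v p - B = \sum_(i < d) p`_i * \sum_(k < n.+1)
     ((k ^_ i)%:R / (n ^_ i)%:R - (k%:R / n%:R) ^+ i) * bernstein_weight v n k.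
    have -> : B = \sum_(i < d) p`_i *
        \sum_(k < n.+1) (k%:R / n%:R) ^+ i * bernstein_weight v n k.
      rewrite /B; under eq_bigr do rewrite horner_coef mulr_suml.
      rewrite exchange_big /=; apply: eq_bigr => i _.
      by rewrite mulr_sumr; apply: eq_bigr => k _; rewrite [RHS]mulrA.
    rewrite momentE -sumrB; apply: eq_bigr => i _.
    have im : (i <= n)%N by rewrite ltnW// (leq_trans (ltn_ord i))// ltnW.
    rewrite (moment_Xn_bernstein v im) -mulrBr -sumrB; congr (_ * _).
    by apply: eq_bigr => k _; rewrite mulrBl.
  suff : `|moment v p - B| <= K / (n - d)%:R.
    by rewrite ler_norml => /andP[h _]; rewrite (le_trans h)// lerBlDr lerDl.
  rewrite E mulr_suml (le_trans (ler_norm_sum _ _ _))// ler_sum// => i _.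
  rewrite normrM -!mulrA ler_wpM2l//.
  have id : (i < d)%N by [].
  have im : (i < n)%N by rewrite (leq_trans id)// ltnW.
  rewrite (le_trans (ler_norm_sum _ _ _))//.
  apply: (@le_trans _ _ (\sum_(k < n.+1)
      (i%:R ^+ 2 / (n - i)%:R) * bernstein_weight v n k)).
    apply: ler_sum => k _; rewrite normrM (ger0_norm (bernstein_weight_ge0 _ _ vcm)).
    by rewrite ler_wpM2r ?bernstein_weight_ge0// ffact_ratio_approx// -ltnS.
  rewrite -mulr_sumr bernstein_weight_sum.
  rewrite [X in _ <= X](_ : _ = d%:R ^+ 2 / (n - d)%:R * v 0%N); last by ring.
  rewrite ler_wpM2r//.
  have ni0 : (0 : R) < (n - i)%:R by rewrite ltr0n subn_gt0.
  rewrite ler_pM ?exprn_ge0 ?invr_ge0//; last first.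
    by rewrite lef_pV2 ?posrE// ler_nat leq_sub2l// ltnW.
  by rewrite ler_pXn2r ?nnegrE// ler_nat ltnW.
rewrite leNgt; apply/negP => L0.
have mL0 : 0 < - moment v p by rewrite oppr_gt0.
pose N := (Num.bound (K / - moment v p)).
have lt_dN : (d < d + N.+1)%N by rewrite addnS ltnS leq_addr.
have := bound _ lt_dN; rewrite addKn lerNl ler_pdivlMr// => H.
have := archi_boundP (divr_ge0 K0 (ltW mL0)).
rewrite ltr_pdivrMr// -/N => KN.
have : K < K; last by rewrite ltxx.
apply: (lt_le_trans KN); apply: le_trans H.
by rewrite mulrC ler_wpM2l ?(ltW mL0)// ler_nat.
Qed.



End Hausdorff.

(** * Inverses of completely monotone sequences *)

(** The convolution of [u] with [(1, -1, 0, 0, ...)]: multiplication of the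
    generating function by [1 - z]. *)
Definition difference (R : realType) (u : nat -> R) : nat -> R :=
  fun n => if n is m.+1 then u n - u m else u 0%N.

Section Inverse.
Variable R : realType.
Implicit Types (u v a b : nat -> R) (p q r : {poly R}).

Lemma convolutionC u v : convolution u v = convolution v u.
Proof.
apply/funext => n; rewrite /convolution (reindex_inj rev_ord_inj) /=.
by apply: eq_bigr => j _; rewrite subSS subKn 1?mulrC // -ltnS.
Qed.

Lemma convolution_difference u v :
  convolution (difference u) v = difference (convolution u v).
Proof.
apply/funext => -[|n]; first by rewrite /= /convolution !big_ord1.
rewrite /= /convolution big_ord_recl [in RHS]big_ord_recl /= -addrA -sumrB.
congr (_ + _); apply: eq_bigr => i _.
by rewrite /bump /= add1n subSS mulrBl.
Qed.

Lemma moment_difference u p :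
  moment (difference u) ('X * p) = - moment u ((1 - 'X) * p).
Proof.
by rewrite -moment_shift -moment_diff [in RHS]moment_sub opprB -moment_sub.
Qed.

(** The product [x^k (1 - x)^j] is a square multiplied by [1], [x], [1 - x] or
    [x (1 - x)], according to the parities of [j] and [k]. In each of the four
    cases a congruence, applied either to the inverse pair [difference b], [a] or
    to the inverse pair [b], [difference a], turns the moment with respect to [a]
    into the moment with respect to [b] of a polynomial nonnegative on [[0, 1]],
    up to a nonnegative constant when the multiplier is [1]. *)
Lemma completely_monotone_inverse a b : completely_monotone b ->
  convolution (difference b) a = @delta_d R -> completely_monotone a.
Proof.
move=> bcm wa; set w := difference b in wa.
have aw : convolution a w = @delta_d R by rewrite convolutionC.
have bc : convolution b (difference a) = @delta_d R.
  by rewrite convolutionC convolution_difference convolutionC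
     -convolution_difference -/w wa.
have b_ge0 p : (forall x : R, 0 <= x <= 1 -> 0 <= p.[x]) -> 0 <= moment b p.
  exact: moment_ge0.
have a0 : 0 <= a 0%N.
  have : w 0%N * a 0%N = 1.
    by have := congr1 (fun v => v 0%N) wa; rewrite /convolution big_ord1 subnn.
  move=> wa0; rewrite leNgt; apply/negP => a0.
  suff : (1 : R) <= 0 by rewrite ler10.
  by rewrite -wa0 mulr_ge0_le0 ?(ltW a0)//; exact: (bcm 0%N 0%N).
have w_a p : poly_part w (poly_part a p) = p by rewrite poly_part_comp wa poly_part_delta.
move=> j k; rewrite iter_diff_moment.
set r := 'X^(k./2) * (1 - 'X) ^+ j./2 : {poly R}.
have -> : 'X^k * (1 - 'X) ^+ j =
    (1 - 'X) ^+ odd j * ('X ^+ odd k * (r * r)) :> {poly R}.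
  rewrite -{1}(odd_double_half k) -{1}(odd_double_half j) -!addnn !exprD /r.
  move: ('X^(odd k)) ('X^(k./2)) ((1 - 'X) ^+ odd j) ((1 - 'X) ^+ j./2) => A B C D.
  ring.
case: (odd j) (odd k) => -[]; rewrite ?expr1 ?expr0 ?mul1r.
- rewrite -[X in _ <= X]opprK -moment_difference.
  have := moment_poly_partXM r r bc.
  rewrite (_ : 'X * ('X * (r * r)) = 'X * r * ('X * r)); last by ring.
  move=> <-; apply: b_ge0 => x _; rewrite hornerM; exact: sqr_ge0.
- rewrite -[X in _ <= X]opprK -moment_difference mulrA.
  rewrite -(moment_XM_poly_part _ _ bc); apply: b_ge0 => x /andP[x0 _].
  by rewrite -mulrA !hornerM hornerX mulr_ge0// -expr2 sqr_ge0.
- rewrite -[r]w_a; move: (poly_part a r) => P.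
  rewrite mulrA (moment_XM_poly_part _ _ aw) -mulrA moment_difference opprK.
  apply: b_ge0 => x /andP[_ x1].
  rewrite hornerM mulr_ge0//; first by rewrite !hornerE subr_ge0.
  by rewrite hornerM -expr2 sqr_ge0.
(* Here only the part of [P] without constant term falls under the congruence;
   the constant term contributes a square and no cross term. *)
rewrite -[r]w_a; move: (poly_part a r) => P.
have [d [Q ->]] : exists d Q, P = d%:P + 'X * Q.
  by elim/poly_XM_ind: P => [|Q d _]; [exists 0, 0; rewrite mulr0 addr0|exists d, Q].
rewrite linearD /= poly_partC.
set s := poly_part w ('X * Q); set e := d * w 0%N.
have s0 : moment a s = 0.
  by rewrite moment_poly_part aw moment_delta coefXM.
have -> : (e%:P + s) * (e%:P + s) = (e ^+ 2)%:P + (2 * e) *: s + s * s.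
  by rewrite -mul_polyC; ring.
rewrite !linearD !linearZ /= s0 scaler0 addr0 momentC /s (moment_poly_partXM _ _ aw).
apply: addr_ge0; first by apply: mulr_ge0 => //; exact: sqr_ge0.
rewrite -mulrA moment_difference opprK; apply: b_ge0 => x /andP[x0 x1].
rewrite (_ : _ * _ = (1 - 'X) * 'X * (Q * Q)); last by ring.
rewrite !hornerM mulr_ge0 -?expr2 ?sqr_ge0// !hornerE mulr_ge0 ?subr_ge0//.
Qed.

End Inverse.

(** * Differences of power functions *)

Section PowerDifferences.
Variable R : realType.
Implicit Types (f g df : R -> R) (r x : R) (j k : nat).

(** The opposite of the forward difference, so that complete monotonicity on the
    half-line means nonnegative iterates. *)
Definition step_diff f : R -> R := fun x => f x - f (x + 1).

Lemma is_derive_step_diff f df : (forall x : R, 0 < x -> is_derive x 1 f (df x)) ->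
  forall x : R, 0 < x -> is_derive x 1 (step_diff f) (step_diff df x).
Proof.
move=> fdf x x0.
have x10 : 0 < x + 1 by rewrite addr_gt0.
have dx := fdf x x0.
have shift : is_derive x 1 (fun y : R => y + 1) 1.
  by have := is_deriveD (is_derive_id x 1) (is_derive_cst (1 : R) x 1); rewrite addr0.
have df1 := @is_derive1_comp R f (fun y => y + 1) x _ _ (fdf _ x10) shift.
by have := is_deriveB dx df1; rewrite mulr1.
Qed.

Lemma is_derive_iter_step_diff f df : (forall x : R, 0 < x -> is_derive x 1 f (df x)) ->
  forall j x, 0 < x -> is_derive x 1 (iter j step_diff f) (iter j step_diff df x).
Proof. by move=> fdf; elim=> [//|j IH] x x0; apply: is_derive_step_diff. Qed.

Lemma iter_step_diffZ c f j x :
  iter j step_diff (fun y : R => c * f y) x = c * iter j step_diff f x.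
Proof. by elim: j x => // j IH x; rewrite !iterS /step_diff !IH mulrBr. Qed.

(** Differences commute with derivation, so the mean value theorem trades one
    difference for one derivative at an intermediate point. *)
Lemma iter_step_diff_MVT f df j x : (forall y : R, 0 < y -> is_derive y 1 f (df y)) ->
  0 < x -> exists2 c, 0 < c & iter j.+1 step_diff f x = - iter j step_diff df c.
Proof.
move=> fdf x0; have dj := is_derive_iter_step_diff fdf j.
have [|||c] := @MVT R (iter j step_diff f) (iter j step_diff df) x (x + 1) _.
- by rewrite ltrDl.
- by move=> y; rewrite in_itv /= => /andP[xy _]; apply: dj; apply: lt_trans xy.
- apply: derivable_within_continuous => y; rewrite in_itv /= => /andP[xy _].
  by have [] := dj y (lt_le_trans x0 xy).
rewrite in_itv /= => /andP[xc _] E; exists c; first exact: lt_trans xc.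
by rewrite /= {1}/step_diff -opprB E addrAC subrr add0r mulr1.
Qed.

Lemma iter_step_diff_powR_ge0 j r x : r <= 0 -> 0 < x ->
  0 <= iter j step_diff (@powR R ^~ r) x.
Proof.
elim: j r x => [|j IH] r x r0 x0; first exact: powR_ge0.
have [c c0 ->] := iter_step_diff_MVT j (fun y : R => @is_derive1_powR R r y) x0.
rewrite (iter_step_diffZ r (@powR R ^~ (r - 1))) -mulNr mulr_ge0 ?oppr_ge0//.
by apply: IH => //; lra.
Qed.

(** What is needed to reach the point [0], where powers of exponent less than
    [1] are not differentiable. *)
Lemma step_diff_right_continuous f :
  (forall x : R, 0 < x -> {for x, continuous f}) -> f x @[x --> 0^'+] --> f 0 ->
  (forall x : R, 0 < x -> {for x, continuous (step_diff f)}) /\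
  step_diff f x @[x --> 0^'+] --> step_diff f 0.
Proof.
move=> fc f0.
have shift (x : R) : y + 1 @[y --> x] --> x + 1.
  by apply: cvgD; [exact: cvg_id|exact: cvg_cst].
split=> [x x0|].
  apply: cvgB; first exact: fc.
  by apply: (cvg_comp _ _ (shift x)); apply: fc; rewrite addr_gt0.
apply: cvgB => //.
have s0 : y + 1 @[y --> (0 : R)^'+] --> (0 + 1 : R).
  by apply: cvg_at_right_filter; exact: shift.
by apply: (cvg_comp _ _ s0); apply: fc; rewrite add0r.
Qed.

(** The derivative of [x^r] is a nonnegative multiple of [x^(r - 1)], a power of
    nonpositive exponent. *)
Lemma iter_step_diff_powR_le0 j r x : 0 < r <= 1 -> 0 <= x ->
  iter j.+1 step_diff (@powR R ^~ r) x <= 0.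
Proof.
move=> /andP[r0 r1].
have pos (y : R) : 0 < y -> iter j.+1 step_diff (@powR R ^~ r) y <= 0.
  move=> y0.
  have [c c0 ->] := iter_step_diff_MVT j (fun y : R => @is_derive1_powR R r y) y0.
  rewrite (iter_step_diffZ r (@powR R ^~ (r - 1))) oppr_le0 mulr_ge0 ?(ltW r0)//.
  by apply: iter_step_diff_powR_ge0 => //; lra.
rewrite le_eqVlt => /predU1P[<-|]; last exact: pos.
pose g := iter j.+1 step_diff (@powR R ^~ r).
have [_ lim0] : (forall x : R, 0 < x -> {for x, continuous g}) /\
    g x @[x --> 0^'+] --> g 0.
  rewrite /g.
  elim: (j.+1) => [|n [nc n0]]; last exact: step_diff_right_continuous.
  split=> [y y0|]; last by rewrite /= powR0 ?gt_eqF//; exact: powR_cvg0.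
  apply: differentiable_continuous; apply/derivable1_diffP.
  by have [] := @is_derive1_powR R r y y0.
rewrite -/(g 0) -(cvg_lim _ lim0)//; apply: limr_le.
  by apply/cvg_ex; exists (g 0).
near=> y; apply: pos; near: y; exact: nbhs_right_gt.
Unshelve. all: by end_near. Qed.

Lemma powR_increments_CM c r : 0 <= c -> 0 < r <= 1 ->
  completely_monotone (fun n => c * (n.+1%:R `^ r - n%:R `^ r) : R).
Proof.
move=> c0 r01 j k.
suff -> : iter j (fun w => w \- seq_shift w) (fun n => c * (n.+1%:R `^ r - n%:R `^ r)) k =
  c * - iter j.+1 step_diff (@powR R ^~ r) k%:R.
  by rewrite mulr_ge0// oppr_ge0 iter_step_diff_powR_le0.
elim: j k => [|j IH] k; first by rewrite /= /step_diff -natr1 opprB.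
rewrite iterS /= /seq_shift !IH -mulrBr; congr (_ * _).
set g := iter j.+1 step_diff _.
rewrite -[RHS]/(- (g k%:R - g (k%:R + 1))) natr1; ring.
Qed.

End PowerDifferences.

(** * The incomplete Gamma integral *)

Section GammaIncrements.
Variables (R : realType) (r : R).
Hypothesis r01 : 0 < r <= 1.
Notation mu := (@lebesgue_measure R).
Implicit Types (a b t x h : R).

(** The integrand of the Gamma function at [1 + r]. The exponential density
    vanishes on the negative half-line, so integrability and measurability can be
    stated on the whole line. *)
Definition gamma_density t : R := t `^ r * exponential_pdf 1 t.

Let pdf_ge0 t : 0 <= exponential_pdf (1 : R) t.
Proof. exact: exponential_pdf_ge0. Qed.

Lemma gamma_density_ge0 t : 0 <= gamma_density t.
Proof. by rewrite mulr_ge0 ?powR_ge0. Qed.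

(** Half of the exponential decay absorbs the power. *)
Lemma powR_le_expR t : 0 <= t -> t `^ r <= 2 * expR (t / 2).
Proof.
case/andP: r01 => r0 r1 t0.
have e1 := expR_ge1Dx (t / 2).
have [t1|t1] := leP t 1.
  have : t `^ r <= 1 `^ r by apply: ge0_ler_powR; rewrite ?nnegrE ?(ltW r0).
  by rewrite powR1; lra.
by have := ler1_powR (ltW t1) r1; lra.
Qed.

Lemma measurable_gamma_density : measurable_fun [set: R] gamma_density.
Proof.
by apply: measurable_funM; [exact: measurable_powR|exact: measurable_exponential_pdf].
Qed.

Lemma integrable_gamma_density : mu.-integrable setT (EFin \o gamma_density).
Proof.
have half : (0 : R) < 2^-1 by rewrite invr_gt0.
have := integrableZl measurableT 4 (integrable_exponential_pdf half).
apply: le_integrable => //.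
  by apply/measurable_EFinP; exact: measurable_gamma_density.
move=> t _ /=; rewrite lee_fin !ger0_norm ?gamma_density_ge0//; last first.
  by rewrite mulr_ge0// exponential_pdf_ge0// ltW.
have [t0|t0] := ltP t 0; first by rewrite /gamma_density !lt0_exponential_pdf// !mulr0.
rewrite /gamma_density !exponential_pdfE// mul1r mulN1r.
have -> : expR (- t) = expR (- (t / 2)) * expR (- (t / 2)) :> R.
  by rewrite -expRD; congr expR; field.
have -> : - 2^-1 * t = - (t / 2) by field.
have -> : 4 * (2^-1 * expR (- (t / 2))) =
    2 * (expR (t / 2) * expR (- (t / 2))) * expR (- (t / 2)) :> R.
  by rewrite -expRD subrr expR0; field.
rewrite !mulrA ler_wpM2r ?expR_ge0// ler_wpM2r ?expR_ge0//.
exact: powR_le_expR.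
Qed.

Let itg (D : set R) : measurable D -> mu.-integrable D (EFin \o gamma_density).
Proof. by move=> mD; apply: integrableS integrable_gamma_density. Qed.

Let ite (D : set R) : measurable D -> mu.-integrable D (EFin \o exponential_pdf (1 : R)).
Proof. by move=> mD; apply: integrableS (integrable_exponential_pdf _). Qed.

Definition lower_gamma x : R := \int[mu]_(t in `[0, x]) gamma_density t.

Lemma Gamma1DE : Gamma (1 + r) = \int[mu]_(t in `[0, +oo[) gamma_density t.
Proof.
rewrite -Rintegral_itv_obnd_cbnd; last exact: itg.
apply: eq_Rintegral => t; rewrite inE /= in_itv /= andbT => t0.
by rewrite /gamma_density exponential_pdfE ?ltW// addrC addKr mul1r mulN1r.
Qed.

Lemma lower_gamma_le x : lower_gamma x <= Gamma (1 + r).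
Proof.
rewrite Gamma1DE /lower_gamma Rintegral_mkcond [leRHS]Rintegral_mkcond.
have itr (D : set R) : measurable D -> mu.-integrable setT (EFin \o gamma_density \_ D).
  move=> mD; rewrite -restrict_EFin; apply/integrable_restrict => //=.
  by rewrite setTI; exact: itg.
apply: le_Rintegral => //; try exact: itr.
move=> t _; rewrite !patchE; case: ifPn => [|_].
  move=> /set_mem; rewrite /= in_itv /= => /andP[t0 _].
  by rewrite ifT// inE /= in_itv /= t0.
by case: ifP => // _; exact: gamma_density_ge0.
Qed.

Lemma cvg_lower_gamma : lower_gamma n%:R @[n --> \oo] --> Gamma (1 + r).
Proof.
have := @ge0_cvgn_integral R mu gamma_density gamma_density_ge0 measurable_gamma_density.
have fin (D : set R) : measurable D -> (\int[mu]_(x in D) (gamma_density x)%:E)%E =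
   (\int[mu]_(x in D) gamma_density x)%:E.
  move=> mD; rewrite fineK//; apply: integrable_fin_num => //; exact: itg.
rewrite fin// -Gamma1DE => H.
exact: (fine_cvg H).
Qed.

Lemma exponential_itv a b : 0 <= a <= b ->
  \int[mu]_(t in `]a, b]) exponential_pdf 1 t = expR (- a) - expR (- b).
Proof.
move=> /andP[a0 ab].
have E x : 0 <= x -> \int[mu]_(t in `[0, x]) exponential_pdf 1 t = 1 - expR (- x).
  rewrite le_eqVlt => /predU1P[<-|x0].
    by rewrite set_itv1 Rintegral_set1 oppr0 expR0 subrr.
  have := @exponential_prob_itv0c R 1 x x0; rewrite mulN1r /exponential_prob /Rintegral.
  by move=> ->.
rewrite -(@Rintegral_itvB _ _ (BLeft 0)) ?bnd_simp//; last exact: ite.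
by rewrite !E ?(le_trans a0)//; ring.
Qed.

(** The factor [t^r] lies between its values at the two ends of the interval, and
    the remaining factor is integrated exactly. *)
Lemma lower_gamma_increment a b : 0 <= a <= b ->
  a `^ r * (expR (- a) - expR (- b)) <= lower_gamma b - lower_gamma a
    <= b `^ r * (expR (- a) - expR (- b)).
Proof.
case/andP: r01 => r0 _ /[dup] ab0 /andP[a0 ab].
rewrite /lower_gamma (@Rintegral_itvB _ _ (BLeft 0)) ?bnd_simp//; last exact: itg.
rewrite -exponential_itv// -!RintegralZl; try by [|exact: ite].
have itz c : mu.-integrable `]a, b] (EFin \o (fun t => c * exponential_pdf 1 t)).
  by apply: (integrableZl _ c (ite (measurable_itv `]a, b]))).
have mono (s t : R) : 0 <= s -> s <= t -> s `^ r <= t `^ r.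
  by move=> s0 st; apply: ge0_ler_powR; rewrite ?nnegrE ?(ltW r0)// (le_trans s0).
apply/andP; split; (apply: le_Rintegral;
  [exact: measurable_itv|try exact: itz; try exact: itg..|]).
all: move=> t /=; rewrite in_itv /= => /andP[at_ tb]; rewrite /gamma_density ler_wpM2r//.
  by apply: mono => //; exact: ltW.
by apply: mono => //; rewrite (le_trans a0)// ltW.
Qed.

Lemma Gamma1D_gt0 : 0 < Gamma (1 + r).
Proof.
have l1 : 0 <= lower_gamma 1 by apply: Rintegral_ge0 => t _; exact: gamma_density_ge0.
have := @lower_gamma_increment 1 2; rewrite powR1 mul1r => /(_ _)/wrap[].
  by rewrite ler01 ler1n.
move=> /andP[H _]; apply: lt_le_trans (lower_gamma_le 2).
have : expR (- 2) < expR (- 1) :> R by rewrite ltr_expR; lra.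
lra.
Qed.

End GammaIncrements.

(** * Generating functions *)

Section GeneratingFunctions.
Variable R : realType.
Implicit Types (u v x y : nat -> R) (z : R).

Lemma completely_monotone_bounds v n : completely_monotone v -> 0 <= v n <= v 0%N.
Proof.
move=> vcm; apply/andP; split; first exact: (vcm 0%N n).
elim: n => // n IH; apply: le_trans IH.
by have := vcm 1%N n; rewrite /= subr_ge0.
Qed.

Lemma completely_monotone_cvg_pseries v z : completely_monotone v ->
  0 <= z < 1 -> cvgn (pseries v z).
Proof.
move=> vcm /andP[z0 z1].
apply: (@series_le_cvg _ _ (geometric (v 0%N) z)).
- move=> n; rewrite mulr_ge0 ?exprn_ge0//.
  by have /andP[] := completely_monotone_bounds n vcm.
- move=> n; rewrite mulr_ge0 ?exprn_ge0//; exact: (vcm 0%N 0%N).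
- move=> n; rewrite ler_wpM2r ?exprn_ge0//.
  by have /andP[] := completely_monotone_bounds n vcm.
- by apply: is_cvg_geometric_series; rewrite ger0_norm.
Qed.

Lemma series_convolution x y n : series (convolution x y) n =
  \sum_(i < n) x i * series y (n - i)%N.
Proof.
elim: n => [|n IH]; first by rewrite big_ord0 /series /= big_geq.
rewrite seriesSr IH big_ord_recr /= subSnn /series /= big_nat1.
rewrite /convolution big_ord_recr /= subnn addrA -big_split /=; congr (_ + _).
apply: eq_bigr => i _; rewrite subSn ?(ltnW (ltn_ord i))//.
by rewrite big_nat_recr//= mulrDr.
Qed.

(** The partial sum of order [n] of the Cauchy product is at most the product of
    the two sums, and that of order [2 n] is at least the product of the two
    partial sums of order [n]. *)
Lemma lim_series_convolution x y : (forall n, 0 <= x n) -> (forall n, 0 <= y n) ->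
  cvgn (series x) -> cvgn (series y) ->
  series (convolution x y) n @[n --> \oo] --> limn (series x) * limn (series y).
Proof.
move=> x0 y0 cx cy.
have ndy : nondecreasing_seq (series y) by apply: nondecreasing_series.
have sy0 n : 0 <= series y n by apply: sumr_ge0.
have ndx : nondecreasing_seq (series x) by apply: nondecreasing_series.
have c0 n : 0 <= convolution x y n by apply: sumr_ge0 => i _; rewrite mulr_ge0.
have ndc : nondecreasing_seq (series (convolution x y)) by apply: nondecreasing_series.
have upper n : series (convolution x y) n <= limn (series x) * limn (series y).
  rewrite series_convolution.
  apply: (@le_trans _ _ (series x n * limn (series y))).
    rewrite /series /= big_mkord mulr_suml; apply: ler_sum => i _.
    by rewrite ler_wpM2l//; apply: nondecreasing_cvgn_le.
  rewrite ler_wpM2r//; last exact: nondecreasing_cvgn_le.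
  by apply: (le_trans (sy0 0%N)); exact: nondecreasing_cvgn_le.
have lower n : series x n * series y n <= series (convolution x y) (n + n)%N.
  rewrite series_convolution big_split_ord /=.
  rewrite -[leLHS]addr0; apply: lerD; last first.
    by apply: sumr_ge0 => i _; rewrite mulr_ge0.
  rewrite /series /= big_mkord mulr_suml; apply: ler_sum => i _.
  by rewrite ler_wpM2l// ndy// -addnBA ?leq_addr// ltnW.
have cc : cvgn (series (convolution x y)).
  apply: nondecreasing_is_cvgn => //.
  by exists (limn (series x) * limn (series y)) => _ [n _ <-].
suff <- : limn (series (convolution x y)) = limn (series x) * limn (series y) by [].
apply/eqP; rewrite eq_le; apply/andP; split.
  by apply: limr_le => //; near=> n; exact: upper.
rewrite -limM//; apply: limr_le; first exact: is_cvgM.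
near=> n; apply: (le_trans (lower n)); exact: nondecreasing_cvgn_le.
Unshelve. all: by end_near. Qed.

Lemma gen_fun_convolution u v z : completely_monotone u -> completely_monotone v ->
  0 <= z < 1 ->
  pseries (convolution u v) z n @[n --> \oo] --> gen_fun u z * gen_fun v z.
Proof.
move=> ucm vcm /[dup] z01 /andP[z0 z1].
have -> : pseries (convolution u v) z =
   series (convolution (fun n => u n * z ^+ n) (fun n => v n * z ^+ n)).
  congr series; apply/funext => n; rewrite /= /convolution mulr_suml.
  apply: eq_bigr => i _; rewrite mulrACA -exprD subnKC//.
  by rewrite -ltnS.
by apply: lim_series_convolution; try (exact: completely_monotone_cvg_pseries);
   move=> n; rewrite mulr_ge0 ?exprn_ge0//;
   [have /andP[] := completely_monotone_bounds n ucm|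
    have /andP[] := completely_monotone_bounds n vcm].
Qed.

End GeneratingFunctions.

Section Asymptotics.
Variables (R : realType) (r : R).
Hypothesis r01 : 0 < r <= 1.
Implicit Types (h : R) (n : nat).

Definition increments n : R := n.+1%:R `^ r - n%:R `^ r.

Lemma completely_monotone_increments : completely_monotone increments.
Proof.
rewrite (_ : increments = fun n => 1 * (n.+1%:R `^ r - n%:R `^ r)).
  exact: powR_increments_CM.
by apply/funext => n; rewrite mul1r.
Qed.

Lemma increments0 : increments 0 = 1.
Proof. by case/andP: r01 => r0 _; rewrite /increments powR1 powR0 ?subr0// gt_eqF. Qed.

Let z h := expR (- h).
(* Multiplied by [h^r], this is the integral of [e^(-t)] times the step function
   equal to [(h (k + 1))^r] between [h k] and [h (k + 1)]. *)
Let riemann h n : R := \sum_(k < n) k.+1%:R `^ r * (z h ^+ k - z h ^+ k.+1).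

Lemma pseries_increments_abel h n :
  pseries increments (z h) n = riemann h n + n%:R `^ r * z h ^+ n.
Proof.
case/andP: r01 => r0 _; elim: n => [|n IH].
  by rewrite /riemann big_ord0 powR0 ?gt_eqF// mul0r addr0 /pseries /series /= big_geq.
rewrite /pseries seriesSr -/(pseries _ _) IH /riemann big_ord_recr /= /increments.
ring.
Qed.

Let expz h n : z h ^+ n = expR (- (h * n%:R)).
Proof. by rewrite /z -expRM_natl mulrN mulrC. Qed.

Lemma riemann_ge h n : 0 < h -> lower_gamma r (h * n%:R) <= h `^ r * riemann h n.
Proof.
move=> h0; elim: n => [|n IH].
  rewrite mulr0 /riemann big_ord0 mulr0 /lower_gamma set_itv1 Rintegral_set1//.
rewrite /riemann big_ord_recr /= -/(riemann h n) mulrDr.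
have ab : 0 <= h * n%:R <= h * n.+1%:R.
  by rewrite mulr_ge0 ?(ltW h0)//= ler_wpM2l ?(ltW h0)// ler_nat.
have /andP[_] := lower_gamma_increment r01 ab.
rewrite powRM ?(ltW h0)// -!expz -mulrA lerBlDl => /le_trans; apply.
by rewrite lerD2r.
Qed.

(** Replacing [k + 1] by [k] in the power costs at most [1], because the increments
    of [n^r] decrease from the value [1]. *)
Lemma riemann_le h n : 0 < h ->
  h `^ r * riemann h n <= lower_gamma r (h * n%:R) + h `^ r * (1 - z h ^+ n).
Proof.
move=> h0; elim: n => [|n IH].
  rewrite mulr0 /riemann big_ord0 mulr0 /lower_gamma set_itv1 Rintegral_set1//.
  by rewrite expr0 subrr mulr0 addr0.
rewrite /riemann big_ord_recr /= -/(riemann h n) mulrDr.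
have ab : 0 <= h * n%:R <= h * n.+1%:R.
  by rewrite mulr_ge0 ?(ltW h0)//= ler_wpM2l ?(ltW h0)// ler_nat.
have /andP[+ _] := lower_gamma_increment r01 ab.
rewrite powRM ?(ltW h0)// -!expz => inc.
have dz : 0 <= z h ^+ n - z h ^+ n.+1.
  by rewrite subr_ge0 !expz ler_expR lerN2; case/andP: ab.
have /andP[_ bn] := completely_monotone_bounds n completely_monotone_increments.
rewrite increments0 /increments in bn.
have : h `^ r * (n.+1%:R `^ r * (z h ^+ n - z h ^+ n.+1)) <=
   h `^ r * n%:R `^ r * (z h ^+ n - z h ^+ n.+1) + h `^ r * (z h ^+ n - z h ^+ n.+1).
  rewrite -mulrA -mulrDr ler_wpM2l ?powR_ge0//.
  by rewrite -[X in _ <= _ + X]mul1r -mulrDl ler_wpM2r//; lra.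
move: IH inc; rewrite !mulrBr !mulr1; lra.
Qed.

(** The boundary term of the summation by parts. *)
Lemma tail_cvg0 h : 0 < h -> (h * n%:R) `^ r * z h ^+ n @[n --> \oo] --> (0 : R).
Proof.
move=> h0.
have z2 : `|expR (- (h / 2))| < 1.
  by rewrite ger0_norm ?expR_ge0// expR_lt1; lra.
apply: (@squeeze_cvgr _ _ _ _ (cst 0) (geometric 2 (expR (- (h / 2))))); last 2 first.
- exact: cvg_cst.
- exact: cvg_geometric.
near=> n; rewrite mulr_ge0 ?powR_ge0 ?exprn_ge0 ?expR_ge0//=.
rewrite expz -expRM_natl.
have hn0 : 0 <= h * n%:R by rewrite mulr_ge0// ltW.
have -> : expR (- (h * n%:R)) = expR (- (h * n%:R / 2)) * expR (- (h * n%:R / 2)).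
  by rewrite -expRD; congr expR; field.
have -> : n%:R * - (h / 2) = - (h * n%:R / 2) by field.
rewrite mulrA ler_wpM2r ?expR_ge0//.
apply: (le_trans (ler_wpM2r (expR_ge0 _) (powR_le_expR r01 hn0))).
by rewrite -[leLHS]mulrA -expRD subrr expR0 mulr1.
Unshelve. all: by end_near. Qed.

(** As [h] tends to [0] this says that the generating function is equivalent to
    [Gamma(1 + r) h^(-r)], with an explicit error. *)
Lemma gen_fun_increments_bounds h : 0 < h ->
  Gamma (1 + r) <= h `^ r * gen_fun increments (z h) <= Gamma (1 + r) + h `^ r.
Proof.
move=> h0.
have z01 : 0 <= z h < 1 by rewrite expR_ge0 expR_lt1 oppr_lt0.
have cp := completely_monotone_cvg_pseries completely_monotone_increments z01.
have P0 n : 0 <= increments n * z h ^+ n.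
  rewrite mulr_ge0 ?exprn_ge0 ?expR_ge0//.
  by have /andP[] := completely_monotone_bounds n completely_monotone_increments.
have ndP : nondecreasing_seq (pseries increments (z h)).
  by apply: nondecreasing_series => n _ _; exact: P0.
apply/andP; split.
  have <- := cvg_lim _ (cvg_lower_gamma r01) => //.
  apply: limr_le; first by apply/cvg_ex; eexists; exact: cvg_lower_gamma.
  (* The Riemann sums reach the abscissa [n] once [N] is at least [n / h]. *)
  near=> n; pose N := (Num.bound (n%:R / h)).
  have nN : n%:R <= h * N%:R.
    by rewrite mulrC -ler_pdivrMr// ltW// archi_boundP// divr_ge0// ltW.
  apply: (@le_trans _ _ (lower_gamma r (h * N%:R))).
    rewrite -subr_ge0; have ab : 0 <= (n%:R : R) <= h * N%:R by rewrite ler0n.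
    have /andP[+ _] := lower_gamma_increment r01 ab; apply: le_trans.
    rewrite mulr_ge0 ?powR_ge0// subr_ge0 ler_expR lerN2//.
  apply: (le_trans (riemann_ge N h0)); rewrite ler_wpM2l ?powR_ge0//.
  apply: (@le_trans _ _ (pseries increments (z h) N)).
    by rewrite pseries_increments_abel lerDl mulr_ge0 ?powR_ge0 ?exprn_ge0 ?expR_ge0.
  exact: nondecreasing_cvgn_le.
have lim1 : h `^ r * pseries increments (z h) n @[n --> \oo] -->
    h `^ r * gen_fun increments (z h).
  by apply: cvgM => //; exact: cvg_cst.
have lim2 : Gamma (1 + r) + h `^ r + (h * n%:R) `^ r * z h ^+ n @[n --> \oo]
   --> Gamma (1 + r) + h `^ r + 0.
  by apply: cvgD; [exact: cvg_cst|exact: tail_cvg0].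
rewrite -[leRHS]addr0; apply: (ler_cvg_to lim1 lim2).
near=> n; rewrite pseries_increments_abel mulrDr.
rewrite powRM ?(ltW h0)// -mulrA lerD2r.
apply: (le_trans (riemann_le n h0)); apply: lerD; first exact: lower_gamma_le.
rewrite ler_piMr ?powR_ge0// lerBlDr lerDl exprn_ge0// expR_ge0.
Unshelve. all: by end_near. Qed.

End Asymptotics.

(** * The L1 scheme *)

Section L1Scheme.
Variables (R : realType) (alpha : R).
Hypotheses (alpha_gt0 : 0 < alpha) (alpha_lt1 : alpha < 1).

Let r : R := 1 - alpha.
Let r01 : 0 < r <= 1. Proof. by rewrite subr_gt0 alpha_lt1 lerBlDr lerDl ltW. Qed.
Let G := Gamma (2 - alpha).

Let GE : Gamma (1 + r) = G.
Proof. by rewrite /G /r; congr Gamma; ring. Qed.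

Let G_gt0 : 0 < G. Proof. by rewrite -GE Gamma1D_gt0. Qed.

(** The weights of the scheme are the differences of this sequence. *)
Definition L1_potential n : R := G^-1 * increments r n.

Lemma L1_potential_CM : completely_monotone L1_potential.
Proof. by apply: powR_increments_CM => //; rewrite invr_ge0 ltW. Qed.

Lemma L1_coefE : L1_coef alpha = difference L1_potential.
Proof.
apply/funext => -[|n] /=; first by rewrite /L1_coef /L1_potential increments0 ?mulr1.
by rewrite /L1_coef /L1_potential /increments /= -/G -/r; ring.
Qed.

Lemma L1_coef_conv_inv :
  convolution (L1_coef alpha) (conv_inv (L1_coef alpha)) = @delta_d R.
Proof. by apply: conv_invP; rewrite /L1_coef eqxx invr_eq0 gt_eqF. Qed.

Let a := conv_inv (L1_coef alpha).

Lemma L1_inverse_CM : completely_monotone a.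
Proof.
apply: (completely_monotone_inverse L1_potential_CM).
by rewrite -L1_coefE L1_coef_conv_inv.
Qed.

Lemma L1_potential_inverse n : convolution L1_potential a n = 1.
Proof.
have : difference (convolution L1_potential a) = @delta_d R.
  by rewrite -convolution_difference -L1_coefE L1_coef_conv_inv.
move=> E; elim: n => [|n IH]; first by have := congr1 (fun v => v 0%N) E.
have := congr1 (fun v => v n.+1) E.
by rewrite /= IH /delta_d /= => /eqP; rewrite subr_eq0 => /eqP.
Qed.

(** From [(1 - z) F_b(z) F_a(z) = 1] with [b = L1_potential]. *)
Lemma L1_gen_fun (z : R) : 0 <= z < 1 ->
  gen_fun a z * gen_fun (increments r) z = G / (1 - z).
Proof.
move=> /[dup] z01 /andP[z0 z1].
have incr : gen_fun L1_potential z = G^-1 * gen_fun (increments r) z.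
  have cp := completely_monotone_cvg_pseries (completely_monotone_increments r01) z01.
  have H : G^-1 * pseries (increments r) z n @[n --> \oo] -->
      G^-1 * gen_fun (increments r) z.
    by apply: cvgM => //; exact: cvg_cst.
  rewrite -(cvg_lim _ H)//; congr (limn _); apply/funext => n.
  by rewrite /pseries /series /= mulr_sumr; apply: eq_bigr => i _; rewrite mulrA.
have lim := gen_fun_convolution L1_potential_CM L1_inverse_CM z01.
have lim' : pseries (convolution L1_potential a) z n @[n --> \oo] --> (1 - z)^-1.
  rewrite (_ : pseries _ z = series (geometric 1 z)).
    rewrite -[(1 - z)^-1]mul1r.
    by apply: cvg_geometric_series; rewrite ger0_norm.
  by congr series; apply/funext => n; rewrite /= L1_potential_inverse.
have := cvg_unique _ lim lim' => /(_ (@norm_hausdorff _ _)).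
rewrite incr => E.
by rewrite -E; field; rewrite gt_eqF.
Qed.

(** With [s = h^r F(e^(-h))] and [F] the generating function of the increments, the
    middle term is [h / (1 - e^(-h)) * (G / s)]. The first factor lies between [1]
    and [e^h], and [s] between [G] and [G + h^r]. *)
Lemma L1_consistency_bounds (h : R) : 0 < h ->
  G / (G + h `^ r) <= h `^ alpha * gen_fun a (expR (- h)) <= expR h.
Proof.
move=> h0; set z := expR (- h).
have z01 : 0 <= z < 1 by rewrite expR_ge0 expR_lt1 oppr_lt0.
have /andP[s1 s2] := gen_fun_increments_bounds r01 h0.
rewrite GE -/z in s1 s2; set s := h `^ r * gen_fun (increments r) z in s1 s2.
have s0 : 0 < s by apply: lt_le_trans s1.
have hr0 : 0 < h `^ r by rewrite powR_gt0.
have z1 : 0 < 1 - z by case/andP: z01; lra.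
have g0 : gen_fun (increments r) z != 0.
  by apply/eqP => E; move: s0; rewrite /s E mulr0 ltxx.
have -> : h `^ alpha * gen_fun a z = h / (1 - z) * (G / s).
  have -> : gen_fun a z = G / (1 - z) / gen_fun (increments r) z.
    by rewrite -(L1_gen_fun z01) mulfK.
  have hE : h = h `^ alpha * h `^ r.
    rewrite -powRD ?(gt_eqF h0) ?implybT// /r addrC subrK powRr1// ltW//.
  rewrite {2}hE /s; field.
  by rewrite g0 (gt_eqF hr0) (gt_eqF z1).
have hz1 : 1 <= h / (1 - z).
  by rewrite ler_pdivlMr// mul1r; have := expR_ge1Dx (- h); rewrite -/z; lra.
have hz2 : h / (1 - z) <= expR h.
  rewrite ler_pdivrMr// mulrBr mulr1 -expRD subrr expR0.
  by have := expR_ge1Dx h; lra.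
have Gs1 : G / s <= 1 by rewrite ler_pdivrMr// mul1r.
have Gs0 : 0 <= G / s by apply: divr_ge0; exact: ltW.
apply/andP; split.
  apply: (@le_trans _ _ (G / s)); last by rewrite ler_peMl.
  by rewrite ler_wpM2l ?(ltW G_gt0)// lef_pV2 ?posrE ?addr_gt0.
apply: le_trans hz2; rewrite ler_piMr//.
by apply: le_trans hz1.
Qed.

Lemma L1_consistent : consistent alpha (L1_coef alpha).
Proof.
split.
  near=> h; apply: completely_monotone_cvg_pseries L1_inverse_CM _.
  by rewrite expR_ge0 expR_lt1 oppr_lt0; near: h; exact: nbhs_right_gt.
apply: (@squeeze_cvgr _ _ _ _ (fun h => G / (G + h `^ r)) expR).
- by near=> h; apply: L1_consistency_bounds; near: h; exact: nbhs_right_gt.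
- have G0 : G + 0 != 0 by rewrite addr0 gt_eqF.
  have -> : 1 = G * (G + 0)^-1 :> R by rewrite addr0 divff ?gt_eqF.
  apply: cvgM; first exact: cvg_cst.
  apply: cvgV => //; apply: cvgD; first exact: cvg_cst.
  by apply: powR_cvg0; case/andP: r01.
- rewrite -(@expR0 R); apply: cvg_at_right_filter; exact: continuous_expR.
Unshelve. all: by end_near. Qed.

End L1Scheme.

Theorem proposition2p4 (R : realType) (alpha : R)
    (alpha_gt0 : 0 < alpha) (alpha_lt1 : alpha < 1) :
  [/\ convolution (L1_coef alpha) (conv_inv (L1_coef alpha)) = @delta_d R,
      completely_monotone (conv_inv (L1_coef alpha))
    & CM_preserving alpha (L1_coef alpha)].
Proof.
split; first exact: L1_coef_conv_inv; first exact: L1_inverse_CM.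
by split; [exact: L1_consistent|exact: L1_inverse_CM].
Qed.
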